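(* Let $m,l,\hbar>0$, $\mu\in\mathbb{N}$ ($\mu\ge1$) and let $b>0$ be the inverse temperature. Let the Gibbs-averaged energy be $$\langle\mathcal{E}_\mu\rangle_{Gibbs}(b)=\sum_{\kappa}w_\kappa\,\mathcal{E}_\kappa .$$ Then $$\langle\mathcal{E}_\mu\rangle_{Gibbs}(b)=-\frac{d}{db}\ln Z(b),\qquad Z(b)=\theta_1\!\left(-\frac12,\ i\frac{4E_\mu}{\pi}b\right),$$ and $$\lim_{b\to+\infty}\langle\mathcal{E}_\mu\rangle_{Gibbs}(b)=E_\mu .$$
   Context: Sums over $\kappa$ run over the wave numbers $\kappa=\frac{\pi\mu}{l}(2k+1)$, $k\in\mathbb{Z}$. $\mathcal{E}_\kappa=\frac{\hbar^2\kappa^2}{2m}$, $Z(b)=\sum_\kappa e^{-b\,\mathcal{E}_\kappa}$, $w_\kappa=\frac{1}{Z(b)}e^{-b\,\mathcal{E}_\kappa}$. $E_\mu=\frac{\pi^2\hbar^2\mu^2}{2ml^2}$ (so $\mathcal{E}_\kappa=E_\mu(2k+1)^2$). $\theta_1(z,\tau)=\sum_{k\in\mathbb{Z}}e^{\,i\frac{\pi\tau}{4}(2k+1)^2+i\frac{\pi}{2}(2z+1)(2k+1)}$ for $z\in\mathbb{C}$, $\operatorname{Im}\tau>0$. *)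

(* Defs.v *)
From Stdlib Require Import Reals ZArith.
From Coquelicot Require Import Coquelicot.

Open Scope R_scope.

(** Bilateral series: both one-sided halves are required to converge. *)
Definition is_sumZ {V : NormedModule R_AbsRing} (f : Z -> V) (s : V) : Prop :=
  exists s1 s2 : V,
    is_series (fun n : nat => f (Z.of_nat n)) s1 /\
    is_series (fun n : nat => f (- Z.of_nat (S n))%Z) s2 /\
    s = plus s1 s2.

(** Meaningful only when some [s] satisfies [is_sumZ f s]. *)
Definition sumZ {V : CompleteNormedModule R_AbsRing} (f : Z -> V) : V :=
  iota (is_sumZ f).

(** Absolute summability, so that the sum does not depend on the
    enumeration of the index set. *)
Definition summableZ {V : NormedModule R_AbsRing} (f : Z -> V) : Prop :=
  ex_series (fun n : nat => norm (f (Z.of_nat n))) /\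
  ex_series (fun n : nat => norm (f (- Z.of_nat (S n))%Z)).

Definition Cexp (z : C) : C :=
  (exp (Re z) * cos (Im z), exp (Re z) * sin (Im z)).

Definition theta1_term (z tau : C) (k : Z) : C :=
  let n : C := RtoC (2 * IZR k + 1) in
  Cexp (Ci * (RtoC PI * tau / RtoC 4) * (n * n)
        + Ci * RtoC (PI / 2) * (RtoC 2 * z + RtoC 1) * n)%C.

(** [C] as a complete normed space over [R], the norm being the modulus. *)
Definition theta1 (z tau : C) : C :=
  sumZ (V := C_R_CompleteNormedModule) (theta1_term z tau).

Definition wave_number (mu : nat) (l : R) (k : Z) : R :=
  PI * INR mu / l * (2 * IZR k + 1).

(** For [mu, l > 0] the map [wave_number mu l] is injective, so sums over the
    set of wave numbers are sums over [k : Z]. *)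
Definition sum_kappa (mu : nat) (l : R) (f : R -> R) : R :=
  sumZ (V := R_CompleteNormedModule) (fun k => f (wave_number mu l k)).

Definition summable_kappa (mu : nat) (l : R) (f : R -> R) : Prop :=
  summableZ (V := R_NormedModule) (fun k => f (wave_number mu l k)).

Definition energy (m hbar kappa : R) : R :=
  hbar ^ 2 * kappa ^ 2 / (2 * m).

Definition E_mu (m l hbar : R) (mu : nat) : R :=
  PI ^ 2 * hbar ^ 2 * INR mu ^ 2 / (2 * m * l ^ 2).

Definition boltzmann (m hbar b kappa : R) : R :=
  exp (- b * energy m hbar kappa).

Definition partition_function (m l hbar : R) (mu : nat) (b : R) : R :=
  sum_kappa mu l (boltzmann m hbar b).

Definition gibbs_weight (m l hbar : R) (mu : nat) (b kappa : R) : R :=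
  1 / partition_function m l hbar mu b * boltzmann m hbar b kappa.

Definition gibbs_energy (m l hbar : R) (mu : nat) (b : R) : R :=
  sum_kappa mu l
    (fun kappa => gibbs_weight m l hbar mu b kappa * energy m hbar kappa).

(* Main.v *)
(** Pairing [k] with [- k - 1] turns both bilateral sums into twice a one-sided
    series over the levels [E (2 n + 1)^2]. For levels [x n >= 0] whose series
    [exp (- c x n)] converges for all [c > 0], the estimate
    [0 <= exp (- u) - 1 + u <= u^2 exp |u|] summed over the levels gives
    termwise differentiation of the partition function. The excess of the mean
    energy over the least level [x 0] is at most the sum of [y exp (- b y)] over
    the gaps [y = x n - x 0], and [y exp (- b y) <= exp (- y) / (b - 1)], so the
    excess is O(1/b). *)

Require Import Defs.
From Stdlib Require Import Reals ZArith Lra Lia.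
From Coquelicot Require Import Coquelicot.
Open Scope R_scope.

(** * Exponential inequalities and series of nonnegative terms *)

(** From [1 + c * x <= exp (c * x)]. It trades a factor [x] for part of the exponential decay. *)
Lemma mul_exp_opp_le (c x : R) : 0 < c -> x * exp (- c * x) <= / c.
Proof.
  intros Hc.
  assert (Hx := exp_ineq1_le (c * x)).
  replace (- c * x) with (- (c * x)) by ring.
  rewrite exp_Ropp.
  assert (He := exp_pos (c * x)).
  apply Rmult_le_reg_r with (c * exp (c * x)).
  - now apply Rmult_lt_0_compat.
  - field_simplify; lra.
Qed.

(** Only [1 + t <= exp t] at [t = u] and [t = - u] is needed. It gives
    [exp (- u) - 1 <= - u * exp (- u)], so the middle term is at most [u * (1 - exp (- u))], and
    [|1 - exp (- u)| <= |u| * exp |u|]. *)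
Lemma exp_opp_taylor_bound (u : R) :
  0 <= exp (- u) - 1 + u <= u ^ 2 * exp (Rabs u).
Proof.
  assert (H1 := exp_ineq1_le (- u)).
  assert (H2 := exp_ineq1_le u).
  assert (He : exp (- u) * exp u = 1)
    by (rewrite <- exp_plus, Rplus_opp_l; apply exp_0).
  assert (P1 := exp_pos (- u)).
  assert (P2 := exp_pos u).
  split; [lra|].
  destruct (Rle_lt_dec 0 u) as [Hu|Hu].
  - rewrite Rabs_pos_eq by assumption.
    assert (exp (- u) * (1 + u) <= 1) by nra.
    assert (1 - exp (- u) <= u) by lra.
    nra.
  - rewrite Rabs_left by assumption.
    assert (exp (- u) - 1 <= - u * exp (- u)) by nra.
    nra.
Qed.

Lemma exp_monotone (x y : R) : x <= y -> exp x <= exp y.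
Proof.
  intros [H| ->]; [left; now apply exp_increasing | apply Rle_refl].
Qed.

Lemma Series_nonneg (a : nat -> R) :
  (forall n, 0 <= a n) -> ex_series a -> 0 <= Series a.
Proof.
  intros Ha Hex.
  rewrite <- (Rmult_0_l (Series a)), <- Series_scal_l.
  apply Series_le; [|assumption].
  intros n; specialize (Ha n); lra.
Qed.

Lemma ex_series_Rmult_l (c : R) (a : nat -> R) :
  ex_series a -> ex_series (fun n => c * a n).
Proof. exact (ex_series_scal_l c a). Qed.

Lemma Series_ge_first (a : nat -> R) :
  (forall n, 0 <= a n) -> ex_series a -> a 0%nat <= Series a.
Proof.
  intros Ha Hex.
  rewrite Series_incr_1 by assumption.
  assert (0 <= Series (fun k => a (S k))).
  { apply Series_nonneg; [intros n; apply Ha|].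
    now apply (ex_series_incr_1 a). }
  lra.
Qed.

(** * Moments and termwise differentiation of a general partition function *)

(** The partition function of the levels [x] is finite at every positive inverse temperature. *)
Definition exp_summable (x : nat -> R) : Prop :=
  forall c : R, 0 < c -> ex_series (fun n => exp (- c * x n)).

(** Induction on [p] for all [b] at once: one factor [x n] is absorbed by half of the exponential,
    and the other half serves the remaining power at [b / 2]. *)
Lemma ex_series_moment (x : nat -> R) (p : nat) (b : R) :
  (forall n, 0 <= x n) -> exp_summable x -> 0 < b ->
  ex_series (fun n => x n ^ p * exp (- b * x n)).
Proof.
  intros Hx Hs; revert b; induction p as [|p IH]; intros b Hb.
  - apply ex_series_ext with (2 := Hs b Hb).
    intros n; simpl; ring.
  - apply (ex_series_le (K := R_AbsRing) (V := R_CompleteNormedModule))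
      with (b := fun n => / (b / 2) * (x n ^ p * exp (- (b / 2) * x n))).
    + intros n; change norm with Rabs.
      assert (Hp := pow_le _ p (Hx n)).
      assert (He := exp_pos (- (b / 2) * x n)).
      assert (Hm := mul_exp_opp_le (b / 2) (x n) ltac:(lra)).
      replace (- b * x n) with (- (b / 2) * x n + - (b / 2) * x n) by field.
      rewrite exp_plus, <- tech_pow_Rmult, Rabs_pos_eq.
      * replace (x n * x n ^ p * (exp (- (b / 2) * x n) * exp (- (b / 2) * x n)))
          with ((x n * exp (- (b / 2) * x n)) * (x n ^ p * exp (- (b / 2) * x n)))
          by ring.
        apply Rmult_le_compat_r; [|assumption].
        apply Rmult_le_pos; lra.
      * specialize (Hx n).
        repeat apply Rmult_le_pos; lra.
    + apply ex_series_Rmult_l.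
      apply IH; lra.
Qed.

Lemma ex_series_first_moment (x : nat -> R) (b : R) :
  (forall n, 0 <= x n) -> exp_summable x -> 0 < b ->
  ex_series (fun n => x n * exp (- b * x n)).
Proof.
  intros Hx Hs Hb.
  apply ex_series_ext with (2 := ex_series_moment x 1 b Hx Hs Hb).
  intros n; simpl; ring.
Qed.

Lemma is_derive_exp_series (x : nat -> R) (b : R) :
  (forall n, 0 <= x n) -> exp_summable x -> 0 < b ->
  is_derive (fun b => Series (fun n => exp (- b * x n))) b
    (- Series (fun n => x n * exp (- b * x n))).
Proof.
  intros Hx Hs Hb.
  apply is_derive_Reals; intros eps Heps.
  set (K := Series (fun n => x n ^ 2 * exp (- (b / 2) * x n))).
  assert (HexK := ex_series_moment x 2 (b / 2) Hx Hs ltac:(lra)).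
  assert (HK : 0 <= K).
  { apply Series_nonneg; [|assumption].
    intros n; apply Rmult_le_pos; [apply pow2_ge_0 | left; apply exp_pos]. }
  (* The bound [|h| < b / 2] keeps the exponent [b - |h|] above [b / 2], so the remainders are
     dominated uniformly in [h]. The bound [|h| * (K + 1) < eps] makes the error [|h| * K] small,
     the [+ 1] covering [K = 0]. *)
  assert (Hd : 0 < Rmin (b / 2) (eps / (K + 1))).
  { apply Rmin_pos; [lra|]. apply Rdiv_lt_0_compat; lra. }
  exists (mkposreal _ Hd); simpl; intros h Hh Hhd.
  assert (Hh1 := Rlt_le_trans _ _ _ Hhd (Rmin_l _ _)).
  assert (Hh2 := Rlt_le_trans _ _ _ Hhd (Rmin_r _ _)).
  assert (Hbh : 0 < b + h) by (revert Hh1; unfold Rabs; destruct Rcase_abs; lra).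
  assert (Hex1 := Hs _ Hbh).
  assert (Hex0 := Hs _ Hb).
  assert (Hexm := ex_series_first_moment x b Hx Hs Hb).
  (* First-order Taylor remainder in [h] of each term; its sum divided by [h] is the error of the
     difference quotient. *)
  set (r := fun n => exp (- (b + h) * x n) - exp (- b * x n)
                     + h * (x n * exp (- b * x n))).
  assert (Hr : forall n, 0 <= r n <= h ^ 2 * (x n ^ 2 * exp (- (b / 2) * x n))).
  { intros n; unfold r.
    replace (- (b + h) * x n) with (- b * x n + - (h * x n)) by ring.
    rewrite exp_plus.
    replace (_ - _ + _)
      with (exp (- b * x n) * (exp (- (h * x n)) - 1 + h * x n)) by ring.
    destruct (exp_opp_taylor_bound (h * x n)) as [T1 T2].
    assert (He := exp_pos (- b * x n)).
    split; [apply Rmult_le_pos; lra|].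
    apply Rle_trans with (1 := Rmult_le_compat_l _ _ _ (Rlt_le _ _ He) T2).
    replace (exp (- b * x n) * ((h * x n) ^ 2 * exp (Rabs (h * x n))))
      with (h ^ 2 * (x n ^ 2 * exp (- b * x n + Rabs (h * x n))))
      by (rewrite exp_plus; ring).
    apply Rmult_le_compat_l; [apply pow2_ge_0|].
    apply Rmult_le_compat_l; [apply pow2_ge_0|].
    apply exp_monotone.
    rewrite Rabs_mult, (Rabs_pos_eq (x n)) by apply Hx.
    specialize (Hx n); nra. }
  assert (HexR : ex_series (fun n => h ^ 2 * (x n ^ 2 * exp (- (b / 2) * x n))))
    by now apply ex_series_Rmult_l.
  assert (Hexr : ex_series r).
  { apply (ex_series_le (K := R_AbsRing) (V := R_CompleteNormedModule))
      with (2 := HexR).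
    intros n; change norm with Rabs.
    rewrite Rabs_pos_eq; apply Hr. }
  assert (S0 := Series_nonneg r (fun n => proj1 (Hr n)) Hexr).
  assert (S1 := Series_le r _ Hr HexR).
  rewrite Series_scal_l in S1; fold K in S1.
  assert (Er : Series r = Series (fun n => exp (- (b + h) * x n))
    - Series (fun n => exp (- b * x n))
    + h * Series (fun n => x n * exp (- b * x n))).
  { unfold r.
    rewrite Series_plus, Series_minus, Series_scal_l; try easy.
    - exact (ex_series_minus _ _ Hex1 Hex0).
    - now apply ex_series_Rmult_l. }
  replace (_ / h - _) with (Series r / h) by (rewrite Er; field; assumption).
  rewrite Rabs_div, (Rabs_pos_eq (Series r)) by assumption.
  assert (Hah := Rabs_pos_lt _ Hh).
  apply Rlt_div_l; [assumption|].
  rewrite <- pow2_abs in S1.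
  apply Rlt_div_r in Hh2; [|lra].
  nra.
Qed.

(** * Mean energy at low temperature *)

Lemma exp_summable_shift (x : nat -> R) (a : R) :
  exp_summable x -> exp_summable (fun n => x n - a).
Proof.
  intros Hs c Hc.
  apply ex_series_ext with (fun n => exp (c * a) * exp (- c * x n)).
  - intros n; rewrite <- exp_plus; f_equal; ring.
  - apply ex_series_Rmult_l, Hs, Hc.
Qed.

Lemma exp_series_pos (x : nat -> R) (b : R) :
  exp_summable x -> 0 < b -> 0 < Series (fun n => exp (- b * x n)).
Proof.
  intros Hs Hb.
  apply Rlt_le_trans with (1 := exp_pos (- b * x 0%nat)).
  apply (Series_ge_first (fun n => exp (- b * x n))); [|now apply Hs].
  intros n; left; apply exp_pos.
Qed.

(** The factor [exp (- b * x 0)] cancels from the quotient, leaving [x 0 + M / D] in terms of the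
    gaps [y]. The gap [y 0 = 0] contributes 1 to [D], so [0 <= M / D <= M]. *)
Lemma mean_energy_bounds (x : nat -> R) (b : R) :
  (forall n, x 0%nat <= x n) -> 0 <= x 0%nat -> exp_summable x -> 1 < b ->
  x 0%nat
    <= Series (fun n => x n * exp (- b * x n)) / Series (fun n => exp (- b * x n))
    <= x 0%nat + Series (fun n => exp (- 1 * (x n - x 0%nat))) * / (b - 1).
Proof.
  intros Hmin Hx0 Hs Hb.
  set (y := fun n => x n - x 0%nat).
  assert (Hy : forall n, 0 <= y n) by (intros n; specialize (Hmin n); unfold y; lra).
  assert (Hsy : exp_summable y) by now apply exp_summable_shift.
  set (K := Series (fun n => exp (- 1 * y n))).
  set (D := Series (fun n => exp (- b * y n))).
  set (M := Series (fun n => y n * exp (- b * y n))).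
  assert (HexD := Hsy b ltac:(lra)).
  assert (HexM := ex_series_first_moment y b Hy Hsy ltac:(lra)).
  assert (HD : 1 <= D).
  { replace 1 with (exp (- b * y 0%nat))
      by (rewrite <- exp_0; f_equal; unfold y; ring).
    apply (Series_ge_first (fun n => exp (- b * y n))); [|assumption].
    intros n; left; apply exp_pos. }
  assert (HM0 : 0 <= M).
  { apply Series_nonneg; [|assumption].
    intros n; apply Rmult_le_pos; [apply Hy | left; apply exp_pos]. }
  assert (HM1 : M <= / (b - 1) * K).
  { unfold K; rewrite <- Series_scal_l.
    apply Series_le.
    - intros n; split.
      + apply Rmult_le_pos; [apply Hy | left; apply exp_pos].
      (* Of the decay rate [b], the share [b - 1] absorbs the factor [y n]; the share 1 leaves a sum
         independent of [b]. *)
      + replace (- b * y n) with (- (b - 1) * y n + - 1 * y n) by ring.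
        rewrite exp_plus, <- Rmult_assoc.
        apply Rmult_le_compat_r; [left; apply exp_pos|].
        apply mul_exp_opp_le; lra.
    - exact (ex_series_Rmult_l _ _ (Hsy 1 Rlt_0_1)). }
  assert (E : forall n, exp (- b * x n) = exp (- b * x 0%nat) * exp (- b * y n)).
  { intros n; rewrite <- exp_plus; f_equal; unfold y; ring. }
  assert (EN : Series (fun n => x n * exp (- b * x n))
               = exp (- b * x 0%nat) * (M + x 0%nat * D)).
  { unfold M, D.
    rewrite <- Series_scal_l, <- Series_plus, <- Series_scal_l; trivial.
    - apply Series_ext; intros n; rewrite E; unfold y; ring.
    - now apply ex_series_Rmult_l. }
  assert (ED : Series (fun n => exp (- b * x n)) = exp (- b * x 0%nat) * D).
  { unfold D; rewrite <- Series_scal_l; now apply Series_ext. }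
  rewrite EN, ED.
  assert (He := exp_pos (- b * x 0%nat)).
  replace (_ / _) with (x 0%nat + M / D) by (field; lra).
  assert (HMD : 0 <= M / D) by (apply Rdiv_le_0_compat; lra).
  assert (HMD' : M / D <= M).
  { apply Rle_div_l; [lra|]; nra. }
  change (Series (fun n => exp (- 1 * (x n - x 0%nat)))) with K.
  lra.
Qed.

Lemma is_lim_mean_energy (x : nat -> R) :
  (forall n, x 0%nat <= x n) -> 0 <= x 0%nat -> exp_summable x ->
  is_lim (fun b => Series (fun n => x n * exp (- b * x n))
                   / Series (fun n => exp (- b * x n)))
    p_infty (x 0%nat).
Proof.
  intros Hmin Hx0 Hs.
  set (K := Series (fun n => exp (- 1 * (x n - x 0%nat)))).
  apply is_lim_le_le_loc
    with (f := fun _ => x 0%nat) (g := fun b => x 0%nat + K * / (b - 1)).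
  - exists 1; intros b Hb; now apply mean_energy_bounds.
  - apply is_lim_const.
  - assert (Hlim : is_lim (fun b => / (b - 1)) p_infty 0).
    { change (Finite 0) with (Rbar_inv p_infty).
      apply is_lim_inv; [|easy].
      apply is_lim_minus with p_infty 1;
        [apply is_lim_id | apply is_lim_const | easy]. }
    replace (Finite (x 0%nat)) with (Rbar_plus (x 0%nat) (Rbar_mult K 0))
      by (simpl; do 2 f_equal; ring).
    apply is_lim_plus'; [apply is_lim_const|].
    now apply (is_lim_scal_l _ K p_infty 0).
Qed.

(** * Bilateral sums and the embedding of real sums in [C] *)

(** Limits of both halves are unique, so [iota] returns the exhibited sum; equations about [sumZ]
    thus reduce to convergence statements. *)
Lemma sumZ_unique {V : CompleteNormedModule R_AbsRing} (f : Z -> V) (s : V) :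
  is_sumZ f s -> sumZ f = s.
Proof.
  intros Hs.
  assert (Huniq : forall t, is_sumZ f t -> s = t).
  { intros t (t1 & t2 & Ht1 & Ht2 & ->).
    destruct Hs as (s1 & s2 & Hs1 & Hs2 & ->).
    now rewrite (filterlim_locally_unique _ _ _ Hs1 Ht1),
      (filterlim_locally_unique _ _ _ Hs2 Ht2). }
  symmetry; apply Huniq.
  unfold sumZ; apply iota_correct.
  exists s; now split.
Qed.

Lemma is_sumZ_ext {V : NormedModule R_AbsRing} (f g : Z -> V) (s : V) :
  (forall k, f k = g k) -> is_sumZ f s -> is_sumZ g s.
Proof.
  intros H (s1 & s2 & H1 & H2 & Hs).
  exists s1, s2; repeat split; trivial.
  - now apply is_series_ext with (2 := H1).
  - now apply is_series_ext with (2 := H2).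
Qed.

Lemma norm_RtoC (x : R) : norm (V := C_R_NormedModule) (RtoC x) = Rabs x.
Proof.
  (* The norm on [C] computes to the Euclidean product norm; dropping the inner absolute values
     leaves [Cmod]. *)
  change (sqrt (Rabs x ^ 2 + Rabs 0 ^ 2) = Rabs x).
  rewrite !pow2_abs; apply Cmod_R.
Qed.

Lemma is_series_RtoC (a : nat -> R) (s : R) :
  is_series a s ->
  is_series (V := C_R_NormedModule) (fun n => RtoC (a n)) (RtoC s).
Proof.
  intros H.
  assert (E : forall n, RtoC (sum_n a n)
                = sum_n (G := C_R_NormedModule) (fun n => RtoC (a n)) n).
  { induction n as [|n IH].
    - now rewrite !sum_O.
    - rewrite !sum_Sn, <- IH; apply RtoC_plus. }
  unfold is_series.
  apply filterlim_ext with (1 := E).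
  intros P [eps HP].
  destruct (H (fun y => ball s eps y)) as [N HN].
  { now exists eps. }
  exists N; intros n Hn; apply HP.
  (* A ball in [C] is a product of balls, and both imaginary parts are 0. *)
  split; [now apply HN | apply ball_center].
Qed.

Lemma is_sumZ_RtoC (f : Z -> R) (s : R) :
  is_sumZ f s -> is_sumZ (V := C_R_NormedModule) (fun k => RtoC (f k)) (RtoC s).
Proof.
  intros (s1 & s2 & H1 & H2 & ->).
  exists (RtoC s1), (RtoC s2); repeat split.
  - now apply is_series_RtoC.
  - now apply (is_series_RtoC (fun n => f (- Z.of_nat (S n))%Z)).
  - apply RtoC_plus.
Qed.

(** * The levels given by squares of odd numbers *)

(** Each level is listed once, by its index [k = n >= 0]; the index [k = - n - 1] has the same
    energy. *)
Definition odd_level (E : R) (n : nat) : R := E * (2 * INR n + 1) ^ 2.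

Lemma odd_level_le (E : R) (n : nat) :
  0 < E -> odd_level E 0%nat <= odd_level E n.
Proof.
  intros HE; unfold odd_level; assert (Hn := pos_INR n); simpl INR.
  apply Rmult_le_compat_l; nra.
Qed.

Lemma odd_level_0 (E : R) : odd_level E 0%nat = E.
Proof. unfold odd_level; simpl; ring. Qed.

Lemma odd_level_ge_0 (E : R) (n : nat) : 0 < E -> 0 <= odd_level E n.
Proof.
  intros HE; assert (H := odd_level_le E n HE); rewrite odd_level_0 in H; lra.
Qed.

(** Comparison with the geometric series of ratio [exp (- (c * E)) < 1], since
    [(2 n + 1)^2 >= n]. *)
Lemma exp_summable_odd_level (E : R) : 0 < E -> exp_summable (odd_level E).
Proof.
  intros HE c Hc.
  assert (Hq : exp (- (c * E)) < 1).
  { rewrite <- exp_0; apply exp_increasing.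
    assert (0 < c * E) by now apply Rmult_lt_0_compat. lra. }
  apply (ex_series_le (K := R_AbsRing) (V := R_CompleteNormedModule))
    with (b := fun n => exp (- (c * E)) ^ n).
  - intros n; change norm with Rabs.
    rewrite Rabs_pos_eq by (left; apply exp_pos).
    rewrite <- Rpower_pow by apply exp_pos.
    unfold Rpower; rewrite ln_exp.
    apply exp_monotone; unfold odd_level.
    assert (Hn := pos_INR n).
    assert (0 < c * E) by now apply Rmult_lt_0_compat.
    nra.
  - apply ex_series_geom.
    rewrite Rabs_pos_eq; [assumption | left; apply exp_pos].
Qed.

Lemma is_sumZ_odd_level (g : R -> R) (E : R) :
  ex_series (fun n => g (odd_level E n)) ->
  is_sumZ (fun k => g (E * (2 * IZR k + 1) ^ 2))
    (2 * Series (fun n => g (odd_level E n))).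
Proof.
  intros Hex.
  set (s := Series (fun n => g (odd_level E n))).
  assert (Hs : is_series (fun n => g (odd_level E n)) s) by now apply Series_correct.
  exists s, s; repeat split.
  - apply is_series_ext with (2 := Hs).
    intros n; now rewrite <- INR_IZR_INZ.
  - apply is_series_ext with (2 := Hs).
    (* Here [k = - (n + 1)], so [2 k + 1 = - (2 n + 1)] and the square is that of the other half. *)
    intros n; rewrite opp_IZR, <- INR_IZR_INZ, S_INR.
    unfold odd_level; f_equal; ring.
  - change (2 * s = s + s); ring.
Qed.

(** Phrased through the norm to cover the real sums and the complex theta series alike. *)
Lemma summableZ_odd_level {V : NormedModule R_AbsRing} (f : Z -> V)
    (g : R -> R) (E : R) :
  (forall k, norm (f k) = g (E * (2 * IZR k + 1) ^ 2)) ->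
  ex_series (fun n => g (odd_level E n)) -> summableZ f.
Proof.
  intros Hf Hex; split; apply ex_series_ext with (2 := Hex); intros n; rewrite Hf.
  - now rewrite <- INR_IZR_INZ.
  - rewrite opp_IZR, <- INR_IZR_INZ, S_INR.
    unfold odd_level; f_equal; ring.
Qed.

(** * Physical energies and theta terms *)

Lemma E_mu_pos (m l hbar : R) (mu : nat) :
  0 < m -> 0 < l -> 0 < hbar -> (1 <= mu)%nat -> 0 < E_mu m l hbar mu.
Proof.
  intros Hm Hl Hh Hmu; unfold E_mu.
  assert (0 < INR mu) by (apply lt_0_INR; lia).
  assert (HPI := PI_RGT_0).
  apply Rdiv_lt_0_compat.
  - rewrite <- !Rpow_mult_distr; apply pow_lt.
    now apply Rmult_lt_0_compat; [apply Rmult_lt_0_compat|].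
  - apply Rmult_lt_0_compat; [lra | now apply pow_lt].
Qed.

Lemma energy_wave_number (m l hbar : R) (mu : nat) (k : Z) :
  0 < m -> 0 < l ->
  energy m hbar (wave_number mu l k) = E_mu m l hbar mu * (2 * IZR k + 1) ^ 2.
Proof.
  intros Hm Hl; unfold energy, wave_number, E_mu; field; split; lra.
Qed.

Lemma Cexp_RtoC (x : R) : Cexp (RtoC x) = RtoC (exp x).
Proof.
  unfold Cexp, RtoC; simpl; rewrite cos_0, sin_0; f_equal; ring.
Qed.

(** At [z = - 1 / 2] the phase [2 z + 1] vanishes, so the terms are real. *)
Lemma theta1_term_mhalf (E b : R) (k : Z) :
  theta1_term (RtoC (- (1 / 2))) (Ci * RtoC (4 * E / PI * b))%C k
  = RtoC (exp (- b * (E * (2 * IZR k + 1) ^ 2))).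
Proof.
  rewrite <- Cexp_RtoC; unfold theta1_term; f_equal.
  assert (HPI := PI_neq0).
  apply injective_projections; simpl; field; assumption.
Qed.

(** * Gibbs energy, theta function and zero-temperature limit *)

Theorem theorem8 (m l hbar : R) (mu : nat)
  (hm : 0 < m) (hl : 0 < l) (hhbar : 0 < hbar) (hmu : (1 <= mu)%nat) :
  (forall b : R, 0 < b ->
     (* the three series converge absolutely *)
     summable_kappa mu l (boltzmann m hbar b) /\
     summable_kappa mu l
       (fun kappa => gibbs_weight m l hbar mu b kappa * energy m hbar kappa) /\
     summableZ (V := C_R_NormedModule)
       (theta1_term (RtoC (- (1 / 2)))
          (Ci * RtoC (4 * E_mu m l hbar mu / PI * b))%C) /\
     ex_derive (fun x : R => ln (partition_function m l hbar mu x)) b /\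
     gibbs_energy m l hbar mu b =
       - Derive (fun x : R => ln (partition_function m l hbar mu x)) b /\
     RtoC (partition_function m l hbar mu b) =
       theta1 (RtoC (- (1 / 2)))
         (Ci * RtoC (4 * E_mu m l hbar mu / PI * b))%C) /\
  is_lim (gibbs_energy m l hbar mu) p_infty (Finite (E_mu m l hbar mu)).
Proof.
  assert (HE := E_mu_pos m l hbar mu hm hl hhbar hmu).
  assert (Hen := fun k => energy_wave_number m l hbar mu k hm hl).
  set (E := E_mu m l hbar mu) in *.
  set (x := odd_level E).
  assert (Hs : exp_summable x) by now apply exp_summable_odd_level.
  assert (Hx : forall n, 0 <= x n) by (intros n; now apply odd_level_ge_0).
  assert (Hm1 := fun b => ex_series_first_moment x b Hx Hs).
  set (D := fun b => Series (fun n => exp (- b * x n))).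
  set (M := fun b => Series (fun n => x n * exp (- b * x n))).
  assert (HsumZ : forall b, 0 < b ->
    is_sumZ (fun k => exp (- b * (E * (2 * IZR k + 1) ^ 2))) (2 * D b)).
  { intros b Hb; now apply (is_sumZ_odd_level (fun y => exp (- b * y))), Hs. }
  assert (HZ : forall b, 0 < b -> partition_function m l hbar mu b = 2 * D b).
  { intros b Hb; apply (sumZ_unique (V := R_CompleteNormedModule)).
    apply is_sumZ_ext with (2 := HsumZ b Hb).
    intros k; unfold boltzmann; now rewrite Hen. }
  assert (HD : forall b, 0 < b -> 0 < D b) by (intros b; now apply exp_series_pos).
  (* The Gibbs summand as a function of the energy alone, the form required for pairing [k] with
     [- k - 1]. *)
  set (w := fun b y => 1 / partition_function m l hbar mu b * exp (- b * y) * y).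
  assert (Hwex : forall b, 0 < b -> ex_series (fun n => w b (x n))).
  { intros b Hb.
    apply ex_series_ext with
      (fun n => 1 / partition_function m l hbar mu b * (x n * exp (- b * x n))).
    - intros n; unfold w.
      rewrite (Rmult_comm (x n)); symmetry; apply Rmult_assoc.
    - now apply ex_series_Rmult_l, Hm1. }
  assert (HG : forall b, 0 < b -> gibbs_energy m l hbar mu b = M b / D b).
  { intros b Hb; apply (sumZ_unique (V := R_CompleteNormedModule)).
    (* The factor 2 from the pairing cancels against the one in the partition function [2 * D b]. *)
    replace (M b / D b) with (2 * Series (fun n => w b (x n))).
    - apply is_sumZ_ext with (2 := is_sumZ_odd_level (w b) E (Hwex b Hb)).
      intros k; unfold gibbs_weight, boltzmann; now rewrite Hen.
    - rewrite (Series_ext _ (fun n => 1 / partition_function m l hbar mu b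
                                      * (x n * exp (- b * x n))))
        by (intros n; unfold w; ring).
      rewrite Series_scal_l, HZ by assumption; fold (M b).
      specialize (HD b Hb); field; lra. }
  split.
  - intros b Hb.
    assert (Hder : is_derive (fun y => ln (partition_function m l hbar mu y)) b
                     (- (M b / D b))).
    (* The formula [2 * D y] is available only for [y > 0], a neighbourhood of [b]; the constant 2
       drops out of the logarithmic derivative. *)
    { apply is_derive_ext_loc with (fun y => ln (2 * D y)).
      - apply (locally_interval _ b 0 p_infty); simpl; trivial.
        intros y Hy _; now rewrite HZ.
      - assert (Hd := is_derive_exp_series x b Hx Hs Hb).
        fold D in Hd; fold (M b) in Hd; specialize (HD b Hb).
        auto_derive.
        + repeat split; [now exists (- M b) | lra].
        + replace (Derive _ b) with (- M b)
            by (symmetry; now apply is_derive_unique).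
          field; lra. }
    split; [|split; [|split; [|split; [|split]]]].
    + apply summableZ_odd_level with (fun y => exp (- b * y)) E.
      * intros k; unfold boltzmann; rewrite Hen.
        change norm with Rabs; apply Rabs_pos_eq; left; apply exp_pos.
      * now apply Hs.
    + apply summableZ_odd_level with (w b) E.
      * intros k; unfold gibbs_weight, boltzmann; rewrite Hen.
        change norm with Rabs; apply Rabs_pos_eq.
        unfold w; rewrite HZ by assumption; specialize (HD b Hb).
        apply Rmult_le_pos; [apply Rmult_le_pos|].
        -- left; apply Rdiv_lt_0_compat; lra.
        -- left; apply exp_pos.
        -- apply Rmult_le_pos; [lra | apply pow2_ge_0].
      * now apply Hwex.
    + apply summableZ_odd_level with (fun y => exp (- b * y)) E.
      * intros k; rewrite theta1_term_mhalf.
        rewrite norm_RtoC; apply Rabs_pos_eq; left; apply exp_pos.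
      * now apply Hs.
    + now exists (- (M b / D b)).
    + rewrite HG by assumption.
      replace (Derive _ b) with (- (M b / D b))
        by (symmetry; now apply is_derive_unique).
      ring.
    + rewrite HZ by assumption; symmetry; unfold theta1.
      apply (sumZ_unique (V := C_R_CompleteNormedModule)).
      apply is_sumZ_ext with (2 := is_sumZ_RtoC _ _ (HsumZ b Hb)).
      intros k; symmetry; apply theta1_term_mhalf.
  - apply is_lim_ext_loc with (fun b => M b / D b).
    + exists 0; intros b Hb; symmetry; now apply HG.
    (* The limit [E] is recognised as the least level. *)
    + rewrite <- (odd_level_0 E).
      apply is_lim_mean_energy; trivial.
      intros n; now apply odd_level_le.
Qed.
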